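(* Let $G$ be a graph of order $n$. (i) If $\delta(G)=6$, then $\gamma_2(G)\le \frac{456883}{918298}\,n<0.498\,n$. (ii) If $\delta(G)=7$, then $\gamma_2(G)\le \frac{140835095}{301690439}\,n<0.467\,n$. (iii) If $\delta(G)=8$, then $\gamma_2(G)\le \frac{292954593}{665571713}\,n<0.441\,n$. (iv) If $\delta(G)\ge 9$, then $\gamma_2(G)\le \frac{60805963517}{145812382205}\,n<0.418\,n$.
   Context: All graphs are finite, simple and undirected; the order of a graph is its number of vertices and $\delta(G)$ denotes the minimum vertex degree. A set $D\subseteq V(G)$ is a $2$-dominating set of $G$ if every vertex of $V(G)\setminus D$ has at least two neighbors in $D$. The $2$-domination number $\gamma_2(G)$ is the minimum cardinality of a $2$-dominating set of $G$. *)

(* Defs.v *)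
From mathcomp Require Import all_boot.

Set Implicit Arguments.
Unset Strict Implicit.
Unset Printing Implicit Defensive.

Record sgraph := SGraph {
  vertex :> finType;
  adj : rel vertex;
  adj_sym : symmetric adj;
  adj_irrefl : irreflexive adj
}.

Section Graph.
Variable G : sgraph.
Implicit Types (v : G) (D : {set G}).

Definition nbhd v : {set G} := [set w | adj v w].

Definition degree v : nat := #|nbhd v|.

(* Every degree is smaller than #|G|, so the default value #|G| is never the
   minimum unless G has no vertex, in which case min_degree is 0. *)
Definition min_degree : nat := \big[minn/#|G|]_(v : G) degree v.

Definition two_dominating D : bool :=
  [forall v in ~: D, 2 <= #|nbhd v :&: D|].

Lemma two_dominatingT : two_dominating [set: G].
Proof. by apply/forall_inP => v; rewrite in_setC in_setT. Qed.

(* [set: G] is only the witness, required by arg min, that a 2-dominating set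
   exists. *)
Definition gamma2 : nat :=
  #|[arg min_(D < [set: G] | two_dominating D) #|D|]|.

Lemma gamma2_min D : two_dominating D -> gamma2 <= #|D|.
Proof.
rewrite /gamma2; case: arg_minnP; first exact: two_dominatingT.
by move=> D0 _ minD0; apply: minD0.
Qed.

Lemma gamma2_attained : exists2 D, two_dominating D & #|D| = gamma2.
Proof.
rewrite /gamma2; case: arg_minnP; first exact: two_dominatingT.
by move=> D0 dD0 _; exists D0.
Qed.

Lemma min_degree_le v : min_degree <= degree v.
Proof.
rewrite /min_degree; have := mem_index_enum v.
elim: (index_enum G) => // w s IHs; rewrite in_cons big_cons geq_min.
by case/predU1P=> [-> | /IHs ->]; rewrite ?leqnn ?orbT.
Qed.

Lemma min_degree_attained : 0 < #|G| -> exists v, degree v = min_degree.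
Proof.
case/card_gt0P=> v0 _.
have [v _ minv] := @arg_minnP G v0 predT degree isT.
exists v; apply/eqP; rewrite eqn_leq min_degree_le andbT.
rewrite /min_degree; elim/big_ind: _ => [|m n le_m le_n|w _].
- exact: max_card.
- by rewrite leq_min le_m le_n.
- exact: minv.
Qed.

End Graph.

(* Main.v *)
(** Given a set D, call a vertex outside D white, yellow or blue when it has 0,
    1 or at least 2 neighbours in D, and active when it is not blue.  A white
    vertex weighs w; a yellow (blue) vertex with i active neighbours weighs y i
    (b i).  While some vertex is active, D can be enlarged by a nonempty set U
    so that the total weight drops by at least s |U|.  Mostly U = {v} where v
    has the largest number of active neighbours in its colour class; but when
    the white vertices have no active neighbour and every blue vertex has at
    most two active neighbours, either a blue vertex with a yellow neighbour is
    good enough or U consists of all white vertices at once.  Starting from the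
    empty set, whose weight is w n, this gives s gamma2 <= w n.  The integer
    weights below are rounded solutions of the linear programs expressing these
    requirements for minimum degree 6, 7, 8 and 9; whether they satisfy them is
    a finite computation. *)

Require Import Defs.
From mathcomp Require Import all_boot.
From Stdlib Require Import Reals Lra.
From mathcomp Require Import zify.

Set Implicit Arguments.
Unset Strict Implicit.
Unset Printing Implicit Defensive.

(** * Colour classes and neighbour counts *)

Section Colours.
Variable G : sgraph.
Implicit Types (D U : {set G}) (v x : G).

Definition ndom D x := #|nbhd x :&: D|.
Definition white D := [set x in ~: D | ndom D x == 0].
Definition yellow D := [set x in ~: D | ndom D x == 1].
Definition blue D := [set x in ~: D | 1 < ndom D x].
Definition active D := [set x in ~: D | ndom D x < 2].
Definition adeg D x := #|nbhd x :&: active D|.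
Definition bdeg D x := #|nbhd x :&: blue D|.

Lemma in_nbhd x v : (x \in nbhd v) = adj v x.
Proof. by rewrite inE. Qed.

Lemma in_nbhdC x v : (x \in nbhd v) = (v \in nbhd x).
Proof. by rewrite !inE adj_sym. Qed.

Lemma nbhdxx v : v \in nbhd v = false.
Proof. by rewrite inE adj_irrefl. Qed.

Lemma activeE D x : (x \in active D) = (x \in white D) || (x \in yellow D).
Proof. by rewrite !inE; case: (x \in D) => //=; lia. Qed.

Lemma sum_bool_mem (A : {set G}) (P : pred G) :
  \sum_(x in A) (P x : nat) = #|[set x in A | P x]|.
Proof. by rewrite -sum1dep_card big_mkcondr. Qed.

Lemma card_nbhdI (C : {set G}) x : #|nbhd x :&: C| = \sum_(u in C) (adj x u : nat).
Proof. by rewrite sum_bool_mem; apply: eq_card => u; rewrite !inE andbC. Qed.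

Lemma sum_card_nbhdI (A B : {set G}) :
  \sum_(x in A) #|nbhd x :&: B| = \sum_(u in B) #|nbhd u :&: A|.
Proof.
under eq_bigr do rewrite card_nbhdI; rewrite exchange_big /=.
by apply: eq_bigr => u _; rewrite card_nbhdI; apply: eq_bigr => x _; rewrite adj_sym.
Qed.

Lemma degree_split D x : degree x = ndom D x + adeg D x + bdeg D x.
Proof.
rewrite /degree -(cardsID D (nbhd x)) -addnA; congr (_ + _).
rewrite -(cardsID (active D) (nbhd x :\: D)); congr (_ + _); apply: eq_card => u.
  by rewrite !inE; case: (u \in D); rewrite ?andbF.
by rewrite !inE; case: (u \in D); case: (adj x u); rewrite ?andbF //=; lia.
Qed.

Lemma leq_card_disjoint (A B C : {set G}) :
  [disjoint A & B] -> A \subset C -> B \subset C -> #|A| + #|B| <= #|C|.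
Proof.
move=> dAB sA sB; move: dAB; rewrite -leq_card_setU => /eqP<-.
by apply: subset_leq_card; rewrite subUset sA.
Qed.

Lemma ndom_setU D U x : [disjoint D & U] ->
  ndom (D :|: U) x = ndom D x + #|nbhd x :&: U|.
Proof.
move=> dDU; rewrite /ndom setIUr cardsU.
suff -> : (nbhd x :&: D) :&: (nbhd x :&: U) = set0 by rewrite cards0 subn0.
by rewrite setIACA setIid (disjoint_setI0 dDU) setI0.
Qed.

Lemma sub_active D U : active (D :|: U) \subset active D.
Proof.
apply/subsetP => x; rewrite !inE negb_or => /andP[/andP[-> _] /=].
by apply: leq_ltn_trans; apply/subset_leq_card/setIS/subsetUl.
Qed.

(** * Decrease of the total weight when [D] grows *)

Section Potential.
Variables (w : nat) (y b : nat -> nat).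
Hypothesis y_mono : forall i j, i <= j -> y i <= y j.
Hypothesis b_mono : forall i j, i <= j -> b i <= b j.

Definition wt c i := match c with 0 => w | 1 => y i | _ => b i end.
Definition wgt D x := wt (ndom D x) (adeg D x).
Definition pot D := \sum_(x in ~: D) wgt D x.

Lemma wgt_white D x : x \in white D -> wgt D x = w.
Proof. by rewrite inE /wgt => /andP[_ /eqP->]. Qed.

Lemma wgt_yellow D x : x \in yellow D -> wgt D x = y (adeg D x).
Proof. by rewrite inE /wgt => /andP[_ /eqP->]. Qed.

Lemma wgt_blue D x : x \in blue D -> wgt D x = b (adeg D x).
Proof. by rewrite inE /wgt => /andP[_]; case: ndom => [|[]]. Qed.

Lemma sum_mul_mem (A B : {set G}) (F : G -> nat) :
  \sum_(x in A) (x \in B) * F x = \sum_(x in A :&: B) F x.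
Proof.
rewrite [RHS](eq_bigl (fun x => (x \in A) && (x \in B))); last by move=> x; rewrite inE.
by rewrite big_mkcondr; apply: eq_bigr => x _; case: (x \in B); rewrite ?mul1n.
Qed.

(* beta bounds the loss of a blue vertex per active neighbour lost, mW and mY
   that of a white and of a yellow neighbour of v; the yellow neighbours of v
   turn blue, and mY includes the resulting loss of their blue neighbours. *)
Lemma pot_setU1 D v (beta mW mY : nat) (e := (v \in active D) : nat) :
  v \notin D ->
  (forall x i j, x \in blue D -> i + j <= adeg D x ->
     b i + beta * j <= b (adeg D x)) ->
  (forall x, x \in nbhd v :&: white D -> mW + y (adeg D x - e) <= w) ->
  (forall x, x \in nbhd v :&: yellow D ->
     mY + b (adeg D x - e) <= y (adeg D x) + beta * (bdeg D x - (1 - e))) ->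
  pot (v |: D) + (wgt D v + e * (beta * bdeg D v)
    + #|nbhd v :&: white D| * mW + #|nbhd v :&: yellow D| * mY) <= pot D.
Proof.
move=> vD hB hW hY; pose Q := nbhd v :&: yellow D; pose R := ~: D :\ v.
have potD : pot D = wgt D v + \sum_(x in R) wgt D x.
  by rewrite /pot (big_setD1 v) // inE.
have potU : pot (v |: D) = \sum_(x in R) wgt (v |: D) x.
  by apply: eq_bigl => x; rewrite !inE negb_or.
have vblue : (v \in blue D : nat) = 1 - e.
  by rewrite /e !inE vD /=; lia.
(* Discharging: on the left a blue [x] pays [beta] per neighbour in [Q]; on the right a vertex of
   [Q] receives [beta] per blue neighbour other than [v]. [B] compares the transfers. *)
have key x : x \in R ->
    wgt (v |: D) x + (x \in blue D) * (beta * (#|nbhd x :&: Q| + e * adj v x))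
      + (x \in nbhd v :&: white D) * mW + (x \in Q) * mY
    <= wgt D x + (x \in Q) * (beta * (bdeg D x - (1 - e))).
  rewrite in_setD1 in_setC => /andP[xv xD].
  have nd : ndom (v |: D) x = ndom D x + adj v x.
    by rewrite setUC ndom_setU ?card_nbhdI ?big_set1 1?adj_sym // disjoint_sym disjoints1.
  pose V := [set v] :&: active D.
  have cV : #|nbhd x :&: V| = e * adj v x.
    by rewrite card_nbhdI -sum_mul_mem big_set1 adj_sym.
  (* Two disjoint sets of active neighbours are lost: those in [Q] turn blue, and [v], if active,
     enters [D]. *)
  have ad : adeg (v |: D) x + (#|nbhd x :&: Q| + e * adj v x) <= adeg D x.
    rewrite -cV; have dQV : [disjoint nbhd x :&: Q & nbhd x :&: V].
      apply/pred0P => u; rewrite /= !in_setI in_set1; case: (u =P v) => [->|].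
        by rewrite nbhdxx !andbF.
      by rewrite !andbF.
    have sA : (nbhd x :&: Q) :|: (nbhd x :&: V) \subset nbhd x :&: active D.
      apply/subsetP => u; rewrite in_setU !in_setI activeE.
      by case/orP => /and3P[-> _ ->]; rewrite ?orbT.
    move: (dQV); rewrite -leq_card_setU => /eqP <-.
    apply: leq_card_disjoint (setIS _ _) sA; last by rewrite setUC sub_active.
    apply/pred0P => u; apply/negP => /= /andP[].
    rewrite in_setI => /andP[_ uA'] /setUP[] /setIP[_].
      move=> /setIP[uv uY]; move: uA' uY; rewrite !inE negb_or.
      case/andP=> /andP[uv' uD] H /andP[_ /eqP H1].
      move: H; rewrite setUC ndom_setU ?H1 ?card_nbhdI ?big_set1; last by rewrite disjoint_sym disjoints1.
      by rewrite adj_sym -in_nbhd uv.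
    by move: uA'; rewrite !inE; case: eqP.
  have wE : (x \in white D) = (ndom D x == 0) by rewrite !inE xD.
  have yE : (x \in yellow D) = (ndom D x == 1) by rewrite !inE xD.
  have bE : (x \in blue D) = (1 < ndom D x) by rewrite !inE xD.
  have xQ : (x \in Q) = adj v x && (ndom D x == 1) by rewrite in_setI in_nbhd yE.
  move: (hB x) (hW x) (hY x).
  rewrite xQ !in_setI ?in_nbhd /wgt nd wE ?yE bE.
  case: (ndom D x) => [|[|n]] /=; rewrite ?andbT ?andbF.
  - move=> _ hWx _; case: (adj v x) hWx ad => [/(_ isT) hWx|_] ad; rewrite /= ?addn0 ?addn1 /=;
      last by rewrite ?mul0n ?addn0.
    have := @y_mono (adeg (v |: D) x) (adeg D x - e); clear -ad hWx; lia.
  - move=> _ _ hYx; case: (adj v x) hYx ad => [/(_ isT) hYx|_] ad; rewrite /= ?addn0 ?addn1 /=.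
      have := @b_mono (adeg (v |: D) x) (adeg D x - e); clear -ad hYx; lia.
    rewrite ?mul0n ?addn0; apply: y_mono; clear -ad; lia.
  - by move=> hBx _ _; have := hBx _ _ isT ad; rewrite mul0n !addn0 mul1n.
have RI (S : {set G}) : S \subset ~: D -> R :&: (nbhd v :&: S) = nbhd v :&: S.
  move=> sS; apply/setIidPr/subsetP => x /setIP[xv /(subsetP sS) xD].
  by rewrite in_setD1 xD andbT; apply: contraL xv => /eqP->; rewrite nbhdxx.
have sD (P : pred G) : [set x in ~: D | P x] \subset ~: D.
  by apply/subsetP => x; rewrite inE => /andP[].
(* Edges between [Q] and the blue vertices are counted from both ends; a blue [v] lies outside [R],
   which costs each vertex of [Q] one blue neighbour. *)
have B : \sum_(i in Q) (bdeg D i - (1 - e)) + e * bdeg D v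
         <= \sum_(i in R :&: blue D) (#|nbhd i :&: Q| + e * adj v i).
  rewrite big_split /= -big_distrr /= -card_nbhdI sum_card_nbhdI; apply: leq_add.
    apply: leq_sum => u _; rewrite -vblue leq_subLR.
    have -> : (v \in blue D : nat) = #|blue D :&: [set v]|.
      by rewrite setIC -sum1_card -sum_mul_mem big_set1 muln1.
    apply: leq_trans (leq_of_leqif (leq_card_setU _ _)).
    apply/subset_leq_card/subsetP => x; rewrite !in_setU !in_setI in_set1 in_setD1.
    case/andP=> xu xB; rewrite xu xB /=; case: eqP => //= _; rewrite andbT.
    by move: xB; rewrite inE => /andP[].
  rewrite leq_mul2l; apply/orP; right; apply/subset_leq_card/subsetP => x.
  rewrite !in_setI => /andP[xv xB]; rewrite xv xB andbT in_setD1.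
  by move: xB; rewrite inE => /andP[-> _]; rewrite andbT; apply: contraL xv => /eqP->; rewrite nbhdxx.
have := leq_sum (index_enum _) key.
rewrite !big_split /= -potU !sum_mul_mem -!big_distrr /= !sum_nat_const !RI ?sD //.
have := leq_mul (leqnn beta) B; rewrite mulnDr (mulnCA beta e) potD -/Q; lia.
Qed.

(* sh is the loss of a blue vertex per white neighbour. *)
Lemma pot_setU_white D (delta sh : nat) :
  (forall x, x \in white D -> adeg D x = 0 /\ delta <= degree x) ->
  (forall x (r := #|nbhd x :&: white D|), x \in blue D ->
     b (adeg D x - r) + sh * r <= b (adeg D x)) ->
  pot (D :|: white D) + #|white D| * (w + delta * sh) <= pot D.
Proof.
move=> hW hB; pose R := ~: (D :|: white D).
have wD x : x \in white D -> x \notin D by rewrite !inE => /andP[].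
have potD : pot D = #|white D| * w + \sum_(x in R) wgt D x.
  rewrite /pot (big_setID (white D)) /=; congr (_ + _).
    rewrite (setIidPr _); last by apply/subsetP => x /wD; rewrite inE.
    rewrite -sum_nat_const; apply: eq_bigr => x; exact: wgt_white.
  by apply: eq_bigl => x; rewrite in_setD /R !in_setC in_setU negb_or andbC.
have dDW : [disjoint D & white D].
  by apply/pred0P => x; apply/negP => /= /andP[xD /wD]; rewrite xD.
have key x : x \in R -> wgt (D :|: white D) x
    + (x \in blue D) * (sh * #|nbhd x :&: white D|) <= wgt D x.
  rewrite in_setC in_setU negb_or => /andP[xD xW].
  have nd := ndom_setU x dDW.
  have ad : adeg (D :|: white D) x + #|nbhd x :&: white D| <= adeg D x.
    apply: leq_card_disjoint; first last.
    - by apply/setIS/subsetP => u; rewrite activeE => ->.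
    - exact/setIS/sub_active.
    - apply/pred0P => u; apply/negP => /= /andP[].
      by rewrite !in_setI => /andP[_ uA] /andP[_ uW]; move: uA; rewrite !inE in uW *; rewrite uW orbT.
  have wE : (x \in white D) = (ndom D x == 0) by rewrite !inE xD.
  have bE : (x \in blue D) = (1 < ndom D x) by rewrite !inE xD.
  move: (hB x) xW; rewrite /wgt nd wE bE.
  case E: (ndom D x) => [|[|n]] //= hBx _.
    (* A white neighbour of the yellow [x] would have [x] as an active neighbour; so there is none
       and [x] stays yellow. *)
    rewrite (_ : #|_| = 0) ?addn0 /=; first by apply: y_mono; lia.
    apply/eqP; rewrite cards_eq0; apply/eqP/setP => u; rewrite in_set0 in_setI.
    apply/negP => /andP[ux uW]; have [u0 _] := hW u uW.
    move/eqP: u0; rewrite cards_eq0 => /eqP/setP/(_ x); rewrite in_set0 in_setI.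
    by rewrite in_nbhdC ux inE in_setC xD E.
  have := hBx isT; have := @b_mono (adeg (D :|: white D) x) (adeg D x - #|nbhd x :&: white D|).
  lia.
have := leq_sum (index_enum _) key.
rewrite !big_split /= -/(pot _) sum_mul_mem -big_distrr /= sum_card_nbhdI.
(* All neighbours of a white vertex are blue, so there are at least [delta] of them. *)
have : #|white D| * delta <= \sum_(u in white D) #|nbhd u :&: (R :&: blue D)|.
  rewrite -sum_nat_const; apply: leq_sum => u uW.
  have [a0 du] := hW u uW; apply: leq_trans du _.
  have /andP[_ /eqP n0] : (u \in ~: D) && (ndom D u == 0) by rewrite inE in uW.
  rewrite (degree_split D) n0 a0 /=; apply/subset_leq_card/setIS/subsetP => x xB.
  rewrite in_setI xB andbT in_setC in_setU negb_or.
  by move: xB; rewrite !inE => /andP[-> H]; rewrite -lt0n (ltnW H).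
move=> H; have := leq_mul (leqnn sh) H; rewrite potD -/R; nia.
Qed.

End Potential.

Lemma adegE D x : adeg D x = #|nbhd x :&: white D| + #|nbhd x :&: yellow D|.
Proof.
rewrite /adeg -(cardsID (white D)); congr (_ + _); apply: eq_card => u.
  by rewrite !in_setI activeE; case: (u \in white D); rewrite ?andbF ?andbT.
rewrite !in_setD !in_setI activeE; case: (boolP (u \in white D)) => //=.
by rewrite !inE => /andP[_ /eqP->]; rewrite !andbF.
Qed.

End Colours.

(** * From finitely many inequalities on the weights to the bound *)

Section Check.
(* The weights are constant from index M.-1 on, so that numbers of active
   neighbours only matter up to M. *)
Variables (delta s w M : nat) (y b : nat -> nat).

Definition beta k := b k - b k.-1.
(* The value s on an empty list plays the role of infinity. *)
Definition minl := foldr minn s.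
(* e = 1 if the vertex v added to D is active, and e = 0 if it is blue. *)
Definition mW e p := minl (if e < p then [:: w - y (p.-1 - e)] else [::]).
(** A yellow neighbour with [x] active neighbours has at least [delta - 1 - x] blue ones, from which
    a blue [v] is discounted. If [v] is active, [x] is at least 1. *)
Definition mY e q k :=
  minl [seq y x + beta k * (delta - (2 - e) - x) - b (x - e) | x <- iota e (q - e)].
Definition mA e p q k := minn (mW e p) (mY e q k).

(* Here p.-1, q.-1 and k are the maximal numbers of active neighbours of the
   white, yellow and blue vertices, with p = 0 (q = 0) when there is no white
   (yellow) vertex.  The first disjunct describes impossible states: there the
   degree bound gives an active vertex a blue neighbour, contradicting k = 0.
   The next three add to D a white, yellow or blue vertex attaining the maximum;
   the last one is the case in which all white vertices may be added. *)
Definition state_ok p q k :=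
  [|| (k == 0) && ((0 < p <= delta) || (0 < q < delta)),
      (0 < p) && (s <= w + beta k * (delta - p.-1) + p.-1 * mA 1 p q k),
      (0 < q) && (s <= y q.-1 + beta k * (delta - q) + q.-1 * mA 1 p q k),
      (0 < k) && (s <= b k + k * mA 0 p q k)
    | [&& p == 1, q <= 1, k <= 2, s <= w + delta * minn (b 1) (b 2)./2
        & [|| k < 2, q == 0 | s <= b 2 + mY 0 q 2 + mA 0 p q 2]]].

Lemma minl_le r x : x \in r -> minl r <= x.
Proof.
elim: r => //= z r IH; rewrite inE geq_min => /predU1P[->|/IH ->]; first by rewrite leqnn.
by rewrite orbT.
Qed.

Hypothesis y_mono : forall i j, i <= j -> y i <= y j.
Hypothesis b_mono : forall i j, i <= j -> b i <= b j.
Hypothesis b_concave : forall i, b i.+2 + b i <= b i.+1 + b i.+1.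
Hypothesis y_tail : forall i, M.-1 <= i -> y i = y M.-1.
Hypothesis b_tail : forall i, M.-1 <= i -> b i = b M.-1.
Hypothesis b0 : b 0 = 0.
Hypothesis le_by : forall i, b i <= y i.
Hypothesis le_yw : forall i, y i <= w.
Hypothesis delta_M : delta <= M.
Hypothesis M_gt2 : 2 < M.

Lemma beta_anti i j : i <= j -> beta j.+1 <= beta i.+1.
Proof.
elim: j => [|j IH]; first by rewrite leqn0 => /eqP->.
rewrite leq_eqVlt => /predU1P[->//|/IH]; apply: leq_trans.
rewrite /beta /=; have := b_concave j; have := @b_mono j j.+1; lia.
Qed.

Lemma beta_steps i j k : i + j <= k -> 0 < k -> b i + beta k * j <= b (i + j).
Proof.
case: k => // k; elim: j => [|j IH] ijk _; first by rewrite muln0 !addn0.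
have {}IH := IH ltac:(lia) isT.
have := @beta_anti (i + j) k ltac:(lia); rewrite {2}/beta /= addnS mulnS.
have := @b_mono (i + j) (i + j).+1; lia.
Qed.

(** If [k < M], concavity makes each of the [j] increments at least [beta k]; otherwise the flat
    tail gives [beta k = 0]. *)
Lemma beta_bound i j d k : minn d M <= k -> i + j <= d -> b i + beta k * j <= b d.
Proof.
move=> dk ijd; have [kM|Mk] := ltnP k M; last first.
  rewrite /beta (@b_tail k) ?(@b_tail k.-1); [|lia..].
  rewrite subnn mul0n addn0; apply: b_mono; lia.
have [k0|k0] := posnP k; first by rewrite /beta k0 /= subnn mul0n addn0; apply: b_mono; lia.
apply: leq_trans (beta_steps _ _) (b_mono ijd) => //; lia.
Qed.

(** For [d > M], [j - e] can be as small as [M.-1], so the weights must be constant from there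
    on. *)
Lemma y_cap d j e : minn d M <= j -> e <= 1 -> y (d - e) <= y (j - e).
Proof.
move=> dj e1; have [dM|Md] := leqP d M; first by apply: y_mono; lia.
rewrite y_tail; last by lia.
by apply: y_mono; lia.
Qed.

Hypothesis all_ok : forall p q k,
  p <= M.+1 -> q <= M.+1 -> k <= M -> 0 < p + q -> state_ok p q k.

Variable G : sgraph.
Hypothesis degG : forall x : G, delta <= degree x.

Local Notation pot := (pot w y b).
Local Notation wgt := (wgt w y b).

Lemma exists_step (D : {set G}) : active D != set0 ->
  exists U : {set G}, [/\ U != set0, [disjoint D & U]
    & pot (D :|: U) + #|U| * s <= pot D].
Proof.
move=> actD; pose md (x : G) := minn (adeg D x) M.
pose p := \max_(x in white D) (md x).+1.
pose q := \max_(x in yellow D) (md x).+1.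
pose k := \max_(x in blue D) md x.
have hp x : x \in white D -> md x < p by move=> xS; apply: (bigmax_sup x).
have hq x : x \in yellow D -> md x < q by move=> xS; apply: (bigmax_sup x).
have hk x : x \in blue D -> md x <= k by move=> xS; apply: (bigmax_sup x).
have mdM x : md x <= M by rewrite geq_minr.
have ex (S : {set G}) F : 0 < \max_(x in S) F x ->
    exists2 v, v \in S & F v = \max_(x in S) F x.
  move=> S0; have: 0 < #|S|.
    by rewrite lt0n; apply: contraTneq S0 => /card0_eq S0; rewrite big_pred0.
  by case/(@eq_bigmax_cond _ (mem S) F) => v vS ->; exists v.
have bdegE x : bdeg D x = degree x - (ndom D x + adeg D x).
  by rewrite (degree_split D) addKn.
have act_adeg x v : x \in nbhd v -> v \in active D -> 0 < adeg D x.
  by move=> xv vA; apply/card_gt0P; exists v; rewrite in_setI in_nbhdC xv.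
(* [pot_setU1] with the worst losses over all counts that [p], [q] and [k] allow. *)
have gain v (e := (v \in active D) : nat) : v \notin D ->
    pot (v |: D) + (wgt D v + e * (beta k * bdeg D v)
      + #|nbhd v :&: white D| * mW e p + #|nbhd v :&: yellow D| * mY e q k) <= pot D.
  move=> vD; have e1 : e <= 1 by rewrite /e; case: (_ \in _).
  apply: (pot_setU1 y_mono b_mono) => //.
  - by move=> x i j /hk; apply: beta_bound.
  - move=> x /setIP[xv xW].
    have ex0 : e <= md x by rewrite /e leq_min; case: (boolP (v \in _)) => //= /(act_adeg _ _ xv); lia.
    have xp := hp x xW.
    have : mW e p <= w - y (p.-1 - e).
      by rewrite /mW (leq_ltn_trans ex0 xp); apply/minl_le/mem_head.
    have xp1 : md x <= p.-1 by case: (p) xp.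
    by move=> mp; rewrite -(subnK (le_yw (p.-1 - e))); apply/leq_add/y_cap.
  - move=> x /setIP[xv xY].
    have ex0 : e <= md x by rewrite /e leq_min; case: (boolP (v \in _)) => //= /(act_adeg _ _ xv); lia.
    have xq := hq x xY.
    have le1 : mY e q k <= y (md x) + beta k * (delta - (2 - e) - md x) - b (md x - e).
      by apply/minl_le/map_f; rewrite mem_iota ex0 subnKC // ltnW // (leq_ltn_trans ex0 xq).
    have n1 : ndom D x = 1 by move: xY; rewrite inE => /andP[_ /eqP].
    have le2 : beta k * (delta - (2 - e) - md x) <= beta k * (bdeg D x - (1 - e)).
      rewrite leq_mul2l; apply/orP; right; have := degG x.
      by rewrite /md bdegE n1; case: (e) e1 => [|[|[]]] //; lia.
    have -> : b (adeg D x - e) = b (md x - e).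
      rewrite /md; case: leqP => // Mx; rewrite b_tail; [rewrite [RHS]b_tail //|]; lia.
    have -> : y (adeg D x) = y (md x).
      rewrite /md; case: leqP => // Mx; rewrite y_tail; [rewrite [RHS]y_tail //|]; lia.
    (* No truncation in [mY]: [b (md x - e) <= b (md x) <= y (md x)]. *)
    have arith (a c d f g h : nat) : a <= c + g - d -> g <= h -> d <= f -> f <= c -> a + d <= c + h.
      by lia.
    exact: arith le1 le2 (b_mono (leq_subr _ _)) (le_by _).
have gain1 v (e := (v \in active D) : nat) : v \notin D ->
    s <= wgt D v + e * (beta k * bdeg D v) + adeg D v * mA e p q k ->
    exists U : {set G}, [/\ U != set0, [disjoint D & U]
      & pot (D :|: U) + #|U| * s <= pot D].
  move=> vD sle; exists [set v]; split.
  - by apply/set0Pn; exists v; rewrite set11.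
  - by rewrite disjoint_sym disjoints1.
  rewrite cards1 mul1n setUC; apply: leq_trans (gain v vD); rewrite leq_add2l -/e.
  apply: leq_trans sle _; rewrite -!addnA !leq_add2l adegE mulnDl.
  by apply: leq_add; rewrite leq_mul2l ?geq_minl ?geq_minr orbT.
have p_le : p <= M.+1 by apply/bigmax_leqP => x _; apply: mdM.
have q_le : q <= M.+1 by apply/bigmax_leqP => x _; apply: mdM.
have k_le : k <= M by apply/bigmax_leqP => x _; apply: mdM.
have pq : 0 < p + q.
  case/set0Pn: actD => x; rewrite activeE addn_gt0 => /orP[/hp|/hq]; lia.
case/orP: (all_ok p_le q_le k_le pq) => [|/or4P[]].
(* With [k = 0] active vertices have no blue neighbour, so a maximal white or yellow one would have
   degree [p.-1] or [q], below [delta]. *)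
- case/andP=> /eqP k0 pqd; have no_blue x u : x \in blue D -> u \in active D -> x \in nbhd u -> False.
    move=> xB uA xu; have := hk x xB; rewrite k0 /md.
    have := act_adeg _ _ xu uA; lia.
  have full u : u \in active D -> bdeg D u = 0.
    move=> uA; apply/eqP; rewrite cards_eq0; apply/eqP/setP => x; rewrite in_set0 in_setI.
    by apply/negP => /andP[xu xB]; apply: (no_blue x u).
  case/orP: pqd => /andP[p0 pd]; have [v vS vp] := ex _ _ p0.
    have vA : v \in active D by rewrite activeE vS.
    have := bdegE v; have := degG v; rewrite full //.
    by move: vp vS; rewrite inE -/p /md => vp /andP[_ /eqP ->]; lia.
  have vA : v \in active D by rewrite activeE vS orbT.
  have := bdegE v; have := degG v; rewrite full //.
  by move: vp vS; rewrite inE -/q /md => vp /andP[_ /eqP ->]; lia.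
- case/andP=> p0 sp; have [v vS vp] := ex _ _ p0.
  have vA : v \in active D by rewrite activeE vS.
  have [vD v0] : v \notin D /\ ndom D v = 0 by move: vS; rewrite !inE => /andP[-> /eqP].
  apply: (gain1 v vD); rewrite vA (wgt_white _ _ _ vS) mul1n.
  apply: leq_trans sp _; apply: leq_add.
    rewrite leq_add2l leq_mul2l; apply/orP; right; rewrite bdegE v0.
    have := degG v; rewrite /p -vp /md; lia.
  by rewrite leq_mul2r; apply/orP; right; rewrite /p -vp /md /= geq_minl.
- case/andP=> q0 sq; have [v vS vq] := ex _ _ q0.
  have vA : v \in active D by rewrite activeE vS orbT.
  have [vD v1] : v \notin D /\ ndom D v = 1 by move: vS; rewrite !inE => /andP[-> /eqP].
  apply: (gain1 v vD); rewrite vA (wgt_yellow _ _ _ vS) mul1n.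
  apply: leq_trans sq _; rewrite /q -vq /= /md; apply: leq_add; last first.
    by rewrite leq_mul2r; apply/orP; right; rewrite geq_minl.
  apply: leq_add; first by apply/y_mono/geq_minl.
  rewrite leq_mul2l; apply/orP; right; rewrite bdegE v1.
  have := degG v; lia.
- case/andP=> k0 sk; have [v vS vk] := ex _ _ k0.
  have vD : v \notin D by move: vS; rewrite !inE => /andP[].
  have vA : (v \in active D) = false.
    by move: vS; rewrite !inE vD /=; lia.
  apply: (gain1 v vD); rewrite vA (wgt_blue _ _ _ vS) mul0n addn0.
  apply: leq_trans sk _; rewrite /k -vk /md; apply: leq_add; first by apply/b_mono/geq_minl.
  by rewrite leq_mul2r; apply/orP; right; rewrite geq_minl.
case/and5P=> /eqP p1 q1 k2 sG sB.
have [/existsP[v /and3P[vB v2 vY]]|noB] :=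
    boolP [exists v, [&& v \in blue D, adeg D v == 2 & nbhd v :&: yellow D != set0]].
  have kE : k = 2 by apply/eqP; rewrite eqn_leq k2; have := hk v vB; rewrite /md (eqP v2); lia.
  have q0 : q != 0.
    by case/set0Pn: vY => u /setIP[_ /hq]; apply: contraTneq => ->.
  rewrite kE (negbTE q0) /= in sB.
  have vD : v \notin D by move: vB; rewrite !inE => /andP[].
  have vA : (v \in active D) = false by move: vB; rewrite !inE vD /=; lia.
  exists [set v]; split; first by apply/set0Pn; exists v; rewrite set11.
    by rewrite disjoint_sym disjoints1.
  rewrite cards1 mul1n setUC; apply: leq_trans (gain v vD); rewrite leq_add2l.
  rewrite vA (wgt_blue _ _ _ vB) (eqP v2) kE mul0n addn0; apply: leq_trans sB _.
  move: vY v2; rewrite -card_gt0 adegE -!addnA leq_add2l.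
  move: #|_ :&: yellow D| #|_ :&: white D| => nY nW nY0 /eqP nWY.
  (* At least one of the two active neighbours is yellow and gains [mY]; the other gains at least
     [mA]. *)
  have [[-> ->]|[-> ->]] : (nY = 1 /\ nW = 1) \/ (nY = 2 /\ nW = 0) by lia.
    by rewrite !mul1n addnC leq_add2r geq_minl.
  by rewrite ?mul0n ?add0n mul2n -addnn leq_add2l geq_minr.
have white0 x : x \in white D -> adeg D x = 0.
  by move=> /hp; rewrite p1 /md; lia.
exists (white D); split.
- have p0 : 0 < p by rewrite p1.
  by have [v vS _] := ex _ _ p0; apply/set0Pn; exists v.
- by apply/pred0P => x; apply/negP => /= /andP[xD]; rewrite !inE xD.
(* Without such a [v], a blue vertex loses none or all of its at most two active neighbours: [b 1]
   for one, [b 2] for two. *)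
suff: pot (D :|: white D) + #|white D| * (w + delta * minn (b 1) (b 2)./2) <= pot D.
  by apply: leq_trans; rewrite leq_add2l leq_mul2l sG orbT.
apply: (pot_setU_white w y_mono b_mono) => [x xW|]; first by rewrite white0.
move=> x r xB; have := hk x xB; have : r <= adeg D x by rewrite adegE leq_addr.
have : r = adeg D x \/ adeg D x != 2.
  have [a2|] := eqVneq (adeg D x) 2; [left|by right].
  move/existsPn/(_ x): noB; rewrite xB a2 /= negbK => /eqP Y0.
  by rewrite adegE Y0 cards0 addn0 in a2 *.
rewrite /md; move: (adeg D x) r => [|[|[|d]]] [|[|[|r]]] //=; rewrite ?muln0 ?addn0 ?subn0 ?b0; lia.
Qed.

(** Each step shrinks the complement of [D] without increasing [s * #|D| + pot D], until no vertex
    is active. *)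
Lemma exists_two_dominating (D : {set G}) :
  exists2 D' : {set G}, two_dominating D' & s * #|D'| <= s * #|D| + pot D.
Proof.
have [n] := ubnP #|~: D|; elim: n D => // n IH D ltD.
have [A0|/exists_step[U [U0 dDU le_pot]]] := eqVneq (active D) set0.
  exists D; last by rewrite leq_addr.
  apply/forall_inP => v; rewrite in_setC => vD.
  by move/setP/(_ v): A0; rewrite !inE vD /= => /negbT; rewrite -leqNgt.
have cU : #|D :|: U| = #|D| + #|U| by apply/eqP; rewrite leq_card_setU.
have cU0 : 0 < #|U| by rewrite card_gt0.
have [|D' dD' le_D'] := IH (D :|: U).
  by move: (cardsC D) (cardsC (D :|: U)) ltD; rewrite cU; lia.
exists D' => //; apply: leq_trans le_D' _.
by rewrite cU mulnDr -addnA leq_add2l addnC mulnC.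
Qed.

Lemma gamma2_bound : s * gamma2 G <= w * #|G|.
Proof.
have [D dD leD] := exists_two_dominating set0.
apply: leq_trans (leq_mul (leqnn s) (gamma2_min dD)) _; apply: leq_trans leD _.
rewrite cards0 muln0 add0n mulnC -cardsT -setC0 -sum_nat_const.
by apply: leq_sum => x _; rewrite wgt_white // inE in_setC in_set0 /ndom setI0 cards0.
Qed.

End Check.

(** * Explicit weights and their verification *)

(* Extends r by repeating its last entry. *)
Definition ext (r : seq nat) i := nth (last 0 r) r i.

Definition weights_ok (delta s w : nat) (ys bs : seq nat) :=
  let M := size ys in let y := ext ys in let b := ext bs in
  [&& size bs == M, delta <= M, 2 < M, sorted leq ys & sorted leq bs]
  && [&& last 0 ys <= w, b 0 == 0,
      all (fun i => b i.+2 + b i <= b i.+1 + b i.+1) (iota 0 M)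
    & all (fun i => b i <= y i) (iota 0 M)]
  && all (fun p => all (fun q => all (fun k => (0 < p + q) ==> state_ok delta s w y b p q k)
       (iota 0 M.+1)) (iota 0 M.+2)) (iota 0 M.+2).

Lemma ext_last r : ext r (size r).-1 = last 0 r.
Proof. by rewrite /ext nth_last; case: r. Qed.

Lemma ext_tail r i : (size r).-1 <= i -> ext r i = ext r (size r).-1.
Proof.
rewrite ext_last => le_i; have [lt_i|le_s] := ltnP i (size r).
  by rewrite -ext_last; congr ext; lia.
exact: nth_default.
Qed.

Lemma ext_mono r : sorted leq r -> forall i j, i <= j -> ext r i <= ext r j.
Proof.
move=> sr i j ij; have [lt_j|le_j] := ltnP j (size r).
  by rewrite /ext (sorted_leq_nth leq_trans leqnn) ?inE // (leq_ltn_trans ij).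
have [lt_i|le_i] := ltnP i (size r); last by rewrite !ext_tail //; lia.
rewrite (@ext_tail r j) /ext; last by lia.
by rewrite (sorted_leq_nth leq_trans leqnn) ?inE //; lia.
Qed.

Lemma weights_gamma2 delta s w ys bs (G : sgraph) :
  weights_ok delta s w ys bs -> delta <= min_degree G -> s * gamma2 G <= w * #|G|.
Proof.
case/andP=> /andP[/and5P[/eqP sbs dM M2 sy sb] /and4P[lw /eqP b0 /allP bc /allP by_]] /allP ok dG.
have ytail i : (size ys).-1 <= i -> ext ys i = ext ys (size ys).-1 by exact: ext_tail.
have btail i : (size ys).-1 <= i -> ext bs i = ext bs (size ys).-1.
  by rewrite -sbs; exact: ext_tail.
apply: (@gamma2_bound delta s w (size ys) (ext ys) (ext bs)) => //.
- exact: ext_mono.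
- exact: ext_mono.
- move=> i; have [lt_i|le_i] := ltnP i (size ys); first by apply: bc; rewrite mem_iota.
  by rewrite !btail //; lia.
- move=> i; have [lt_i|le_i] := ltnP i (size ys); first by apply: by_; rewrite mem_iota.
  by rewrite ytail ?btail; [apply: by_; rewrite mem_iota|..]; lia.
- move=> i; apply: leq_trans lw; rewrite -ext_last.
  by have [/ytail->//|/ltnW] := leqP (size ys).-1 i; apply: ext_mono.
- move=> p q k pM qM kM pq.
  have /allP/(_ q) : all (fun q => all (fun k => (0 < p + q) ==> state_ok delta s w (ext ys) (ext bs) p q k)
       (iota 0 (size ys).+1)) (iota 0 (size ys).+2) by apply: ok; rewrite mem_iota.
  by rewrite mem_iota => /(_ qM)/allP/(_ k); rewrite mem_iota pq => /(_ kM).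
- by move=> x; apply: leq_trans dG (min_degree_le x).
Qed.

Lemma weights6_ok : weights_ok 6 2000 995 [:: 465; 585; 705; 746; 787; 826; 850]
  [:: 0; 307; 447; 542; 590; 638; 685].
Proof. by vm_compute. Qed.

Lemma weights7_ok : weights_ok 7 2000 933 [:: 405; 516; 624; 692; 721; 750; 779; 799]
  [:: 0; 266; 400; 491; 539; 575; 611; 646].
Proof. by vm_compute. Qed.

Lemma weights8_ok : weights_ok 8 1500 660
  [:: 250; 337; 426; 470; 503; 520; 537; 555; 566]
  [:: 0; 179; 274; 336; 369; 397; 419; 440; 460].
Proof. by vm_compute. Qed.

Lemma weights9_ok : weights_ok 9 2000 834
  [:: 276; 395; 513; 575; 618; 648; 666; 685; 703; 713]
  [:: 0; 216; 336; 412; 454; 490; 518; 540; 561; 581].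
Proof. by vm_compute. Qed.

(** * Passage to the real constants *)

Lemma gamma2_real_bounds (G : sgraph) (n s w : nat) (c c' : R) :
  #|G| = n -> 0 < min_degree G -> s * gamma2 G <= w * #|G| ->
  (0 < INR s)%R -> (INR w <= c * INR s)%R -> (c < c')%R ->
  (INR (gamma2 G) <= c * INR n < c' * INR n)%R.
Proof.
move=> <- dG /leP/le_INR; rewrite !mult_INR => le_sw s0 le_wc lt_c.
(* The strict inequality needs a nonempty graph, and the empty one has [min_degree] 0. *)
have [v _] : exists v : G, true.
  suff: 0 < #|G| by case/card_gt0P => v _; exists v.
  rewrite lt0n; apply: contraTneq dG => G0.
  by rewrite /min_degree big_pred0 ?G0 // => v; apply: (card0_eq G0).
have n0 : (0 < INR #|G|)%R by apply/lt_0_INR/ltP/card_gt0P; exists v.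
split; last by apply: Rmult_lt_compat_r.
apply: (Rmult_le_reg_l (INR s)) => //; apply: Rle_trans le_sw _.
have := Rmult_le_compat_r _ _ _ (Rlt_le _ _ n0) le_wc; lra.
Qed.

Theorem corollary1 (G : sgraph) (n : nat) (order_G : #|G| = n) :
  (min_degree G = 6 ->
    (INR (gamma2 G) <= 456883 / 918298 * INR n < 0.498 * INR n)%R) /\
  (min_degree G = 7 ->
    (INR (gamma2 G) <= 140835095 / 301690439 * INR n < 0.467 * INR n)%R) /\
  (min_degree G = 8 ->
    (INR (gamma2 G) <= 292954593 / 665571713 * INR n < 0.441 * INR n)%R) /\
  (9 <= min_degree G ->
    (INR (gamma2 G) <= 60805963517 / 145812382205 * INR n
       < 0.418 * INR n)%R).
Proof.
split; [|split; [|split]] => dG.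
- by apply: (gamma2_real_bounds order_G _ (weights_gamma2 weights6_ok _));
    rewrite ?dG // ?INR_IZR_INZ; simpl; lra.
- by apply: (gamma2_real_bounds order_G _ (weights_gamma2 weights7_ok _));
    rewrite ?dG // ?INR_IZR_INZ; simpl; lra.
- by apply: (gamma2_real_bounds order_G _ (weights_gamma2 weights8_ok _));
    rewrite ?dG // ?INR_IZR_INZ; simpl; lra.
- apply: (gamma2_real_bounds order_G _ (weights_gamma2 weights9_ok dG));
    first exact: leq_trans dG.
  all: by rewrite ?INR_IZR_INZ; simpl; lra.
Qed.
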